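(* The set of operators $\{xI+yE: x,y\in\mathbb{R}\}$ acting on the space $\mathbb{AP}_2$ of all $2$-antiperiodic functions, where $I$ is the identity operator and $E$ is the unit shift operator on $\mathbb{AP}_2$ (so that $E^2=-I$), is a field under addition and composition of operators.
   Context: $\mathbb{AP}_2$ is the real vector space of all functions $f:\mathbb{R}\to\mathbb{R}$ with $f(t+2)=-f(t)$ for all $t\in\mathbb{R}$. The unit shift operator is $(Ef)(t)=f(t+1)$; it maps $\mathbb{AP}_2$ to itself. *)

(* Defs.v *)
From HB Require Import structures.
From mathcomp Require Import all_boot all_order all_algebra.
From mathcomp Require Import boolp classical_sets functions reals normedtype trigo.

Set Implicit Arguments.
Unset Strict Implicit.
Unset Printing Implicit Defensive.

Import GRing.Theory numFieldNormedType.Exports.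

Local Open Scope classical_set_scope.
Local Open Scope ring_scope.

(* [alternating] is the library's name for antiperiodic. *)
Definition AP2_pred (R : realType) : {pred R -> R} :=
  [pred f : R -> R | `[< alternating f 2 >]].
Arguments AP2_pred : clear implicits.

Lemma AP2_submod_closed (R : realType) :
  @GRing.submod_closed R (R -> R) (AP2_pred R).
Proof.
split=> [|a f g /asboolP hf /asboolP hg]; apply/asboolP => t.
  by rewrite /= oppr0.
by rewrite !fctE hf hg scalerN opprD.
Qed.

HB.instance Definition _ (R : realType) :=
  GRing.isSubmodClosed.Build R (R -> R) (AP2_pred R) (@AP2_submod_closed R).

Record AP2 (R : realType) := MkAP2 {
  AP2_val :> R -> R;
  AP2_valP : AP2_val \in AP2_pred R }.

HB.instance Definition _ (R : realType) := [isSub for @AP2_val R].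
HB.instance Definition _ (R : realType) := [Choice of AP2 R by <:].
HB.instance Definition _ (R : realType) :=
  [SubChoice_isSubLmodule of AP2 R by <:].

Lemma AP2_shift_subproof (R : realType) (f : AP2 R) :
  (fun t : R => f (t + 1)) \in AP2_pred R.
Proof.
by apply/asboolP => t; rewrite addrAC; apply: (asboolP _ (AP2_valP f)).
Qed.

Definition AP2_shift (R : realType) (f : AP2 R) : AP2 R :=
  MkAP2 (AP2_shift_subproof f).

Lemma AP2_shift_is_linear (R : realType) : linear (@AP2_shift R).
Proof. by move=> a f g; apply/val_inj. Qed.

HB.instance Definition _ (R : realType) :=
  GRing.isLinear.Build R (AP2 R) (AP2 R) *:%R (@AP2_shift R) (@AP2_shift_is_linear R).

(* The addition and scaling of operators are the pointwise ones that
   [functions] puts on [AP2 R -> AP2 R]. *)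
Definition AP2_operators (R : realType) : set (AP2 R -> AP2 R) :=
  [set A | exists x y : R, A = x *: idfun + y *: @AP2_shift R].
Arguments AP2_operators : clear implicits.

(* The subset [S] carries a [fieldType] structure whose sum and product are the
   restrictions of [add] and [mul] (so [S] is in particular closed under both).
   A field determines its zero, one, opposites and inverses from its sum and
   product, so these need not be prescribed. *)
Definition is_field_under (T : Type) (S : set T) (add mul : T -> T -> T) :
    Prop :=
  exists c : GRing.Field S,
    let F : fieldType := GRing.Field.Pack c in
    (forall a b : F, val (a + b : S) = add (val (a : S)) (val (b : S))) /\
    (forall a b : F, val (a * b : S) = mul (val (a : S)) (val (b : S))).

(* Main.v *)
Require Import Defs.
From HB Require Import structures.
From mathcomp Require Import all_boot all_order all_algebra.
From mathcomp Require Import boolp classical_sets functions reals normedtype trigo.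
From mathcomp Require Import ring.

Import GRing.Theory Num.Theory.

Local Open Scope ring_scope.

(** Antiperiodicity says that the shift [E] satisfies [E^2 = -I], so the
    operators [xI + yE] compose like the complex numbers [x + iy]
    ([lincomb_comp]): they are closed under composition, commute with each
    other, and [xI + yE] has the inverse [(xI - yE) / (x^2 + y^2)] unless
    [x = y = 0] ([operator_unit]).  Since [E] is linear, composition also
    distributes over the pointwise sum.

    The one analytic input is that the space of antiperiodic functions is
    nonzero, without which [I = 0] and there would be no field; the witness is
    [cos (pi t / 2)] ([AP2_cos]). *)

Lemma AP2_shift_shift {R : realType} (f : AP2 R) :
  AP2_shift (AP2_shift f) = - f.
Proof.
apply/val_inj/funext => t /=; rewrite -addrA.
exact: (asboolP _ (AP2_valP f)).
Qed.

Lemma cos_half_pi_mul_antiperiodic (R : realType) :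
  (fun t : R => cos (pi / 2 * t)) \in AP2_pred R.
Proof. by apply/asboolP => t; rewrite mulrDr divfK ?pnatr_eq0// cosDpi. Qed.

Definition AP2_cos (R : realType) : AP2 R :=
  MkAP2 (cos_half_pi_mul_antiperiodic R).

Lemma AP2_cos_neq0 (R : realType) : AP2_cos R <> 0.
Proof.
move=> /(congr1 (fun f : AP2 R => f 0)) /=.
by rewrite mulr0 cos0; apply/eqP/oner_neq0.
Qed.

Definition lincomb {R : realType} (x y : R) : AP2 R -> AP2 R :=
  x *: idfun + y *: @AP2_shift R.

Lemma lincombE {R : realType} (x y : R) f :
  lincomb x y f = x *: f + y *: AP2_shift f.
Proof. by []. Qed.

(** This is the multiplication rule of the complex numbers, with [E] in the
    role of [i]. *)
Lemma lincomb_comp {R : realType} (x y u v : R) :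
  lincomb x y \o lincomb u v = lincomb (x * u - y * v) (x * v + y * u).
Proof.
apply/funext => f /=.
rewrite !lincombE [AP2_shift (_ + _)]linearD /= ![AP2_shift (_ *: _)]linearZ /=.
rewrite AP2_shift_shift.
rewrite !scalerDr !scalerDl !scalerA scalerN scaleNr.
by rewrite [y * u *: _ - _]addrC addrACA.
Qed.

Lemma lincomb_in {R : realType} (x y : R) : lincomb x y \in AP2_operators R.
Proof. by apply/mem_set; exists x, y. Qed.

(** A head constant of its own, from which the algebraic structures declared
    below are inferred. *)
Definition AP2_operator (R : realType) := set_type (AP2_operators R).

HB.instance Definition _ (R : realType) := SubChoice.on (AP2_operator R).

Definition operator {R : realType} (x y : R) : AP2_operator R :=
  exist _ (lincomb x y) (lincomb_in x y).

Lemma operatorP {R : realType} (A : AP2_operator R) :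
  exists x y, A = operator x y.
Proof.
have /set_mem[x [y Axy]] := valP A.
by exists x, y; apply: val_inj.
Qed.

Lemma AP2_operators0 (R : realType) : 0 \in AP2_operators R.
Proof. by apply/mem_set; exists 0, 0; rewrite !scale0r addr0. Qed.

Lemma AP2_operators_id (R : realType) : idfun \in AP2_operators R.
Proof. by apply/mem_set; exists 1, 0; rewrite scale1r scale0r addr0. Qed.

Lemma AP2_operatorsD {R : realType} (A B : AP2_operator R) :
  val A + val B \in AP2_operators R.
Proof.
have [x [y ->]] := operatorP A; have [u [v ->]] := operatorP B.
by apply/mem_set; exists (x + u), (y + v); rewrite !scalerDl addrACA.
Qed.

Lemma AP2_operatorsN {R : realType} (A : AP2_operator R) :
  - val A \in AP2_operators R.
Proof.
have [x [y ->]] := operatorP A.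
by apply/mem_set; exists (- x), (- y); rewrite !scaleNr -opprD.
Qed.

Lemma AP2_operators_comp {R : realType} (A B : AP2_operator R) :
  val A \o val B \in AP2_operators R.
Proof.
have [x [y ->]] := operatorP A; have [u [v ->]] := operatorP B.
by rewrite lincomb_comp lincomb_in.
Qed.

Section OperatorField.
Variable R : realType.
Local Notation F := (AP2_operator R).

Definition operator_zero : F := exist _ 0 (AP2_operators0 R).
Definition operator_one : F := exist _ idfun (AP2_operators_id R).
Definition operator_add (A B : F) : F :=
  exist _ (val A + val B) (AP2_operatorsD A B).
Definition operator_opp (A : F) : F := exist _ (- val A) (AP2_operatorsN A).
Definition operator_mul (A B : F) : F :=
  exist _ (val A \o val B) (AP2_operators_comp A B).

Lemma operator_addA : associative operator_add.
Proof. by move=> A B C; apply/val_inj/addrA. Qed.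

Lemma operator_addC : commutative operator_add.
Proof. by move=> A B; apply/val_inj/addrC. Qed.

Lemma operator_add0 : left_id operator_zero operator_add.
Proof. by move=> A; apply/val_inj/add0r. Qed.

Lemma operator_addN : left_inverse operator_zero operator_opp operator_add.
Proof. by move=> A; apply/val_inj/addNr. Qed.

HB.instance Definition _ := GRing.isZmodule.Build F
  operator_addA operator_addC operator_add0 operator_addN.

Lemma operator_mulA : associative operator_mul.
Proof. by move=> A B C; apply/val_inj. Qed.

Lemma operator_mulC : commutative operator_mul.
Proof.
move=> A B; have [x [y ->]] := operatorP A; have [u [v ->]] := operatorP B.
by apply/val_inj; rewrite /= !lincomb_comp; congr lincomb; ring.
Qed.

Lemma operator_mul1 : left_id operator_one operator_mul.
Proof. by move=> A; apply/val_inj. Qed.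

(** Composing a pointwise sum with an operator on its right distributes by
    definition; linearity of [E] enters the other distributive law through
    commutativity. *)
Lemma operator_mulDl : left_distributive operator_mul operator_add.
Proof. by move=> A B C; apply/val_inj. Qed.

Lemma operator_one_neq0 : operator_one != operator_zero.
Proof.
apply/eqP => /(congr1 (fun A : F => val A (AP2_cos R))).
exact: AP2_cos_neq0.
Qed.

HB.instance Definition _ := GRing.Zmodule_isComNzRing.Build F
  operator_mulA operator_mulC operator_mul1 operator_mulDl operator_one_neq0.

(** The inverse is the conjugate divided by the squared modulus, which is
    nonzero because a sum of two real squares vanishes only if both do. *)
Lemma operator_unit (A : F) : A != 0 -> exists B : F, B * A = 1.
Proof.
have [x [y ->]] := operatorP A => A_neq0.
set n := x ^+ 2 + y ^+ 2.
have n_neq0 : n != 0.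
  apply: contra_neq A_neq0 => /eqP.
  rewrite paddr_eq0 ?sqr_ge0// !sqrf_eq0 => /andP[/eqP-> /eqP->].
  by apply/val_inj; rewrite /= /lincomb !scale0r addr0.
exists (operator (x / n) (- y / n)).
apply/val_inj; rewrite /= lincomb_comp.
have -> : x / n * x - - y / n * y = 1 by rewrite /n; field.
have -> : x / n * y + - y / n * x = 0 by rewrite /n; field.
by rewrite /lincomb scale1r scale0r addr0.
Qed.

(** Choosing an inverse operator, instead of computing one from chosen
    coefficients, makes the value at [0] the default [0]. *)
Definition operator_inv (A : F) : F := xget 0 [set B : F | B * A = 1]%classic.

Lemma operator_mulV (A : F) : A != 0 -> operator_inv A * A = 1.
Proof. by move=> /operator_unit exB; apply: (xgetPex 0 exB). Qed.

Lemma operator_inv0 : operator_inv 0 = 0.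
Proof.
by apply: xgetPN => B /=; apply/eqP; rewrite mulr0 eq_sym oner_neq0.
Qed.

HB.instance Definition _ := GRing.ComNzRing_isField.Build F
  operator_mulV operator_inv0.

End OperatorField.

Theorem theorem3p4 (R : realType) :
  @AP2_shift R \o @AP2_shift R = - idfun :> (AP2 R -> AP2 R) /\
  is_field_under (AP2_operators R) (fun A B => A + B) (fun A B => A \o B).
Proof.
split; first by apply/funext => f; apply: AP2_shift_shift.
by exists (GRing.Field.class (AP2_operator R : fieldType)).
Qed.
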